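(* Let $K$ be a commutative unital ring and let $B:\mathbb{W}\to\mathbb{V}$ be a butterfly of $2$-term $L_\infty$-algebras over $K$, with middle term $E$ and structure maps $\kappa,\iota,\sigma,\rho$. Let $\mathrm{hfib}(B)$ be its homotopy fiber, i.e. the complex $W_1\xrightarrow{\kappa}E\xrightarrow{\rho}V_0$ with terms in degrees $1,0,-1$. Then there is a long exact sequence $$0\to H_1(\mathrm{hfib}(B))\to H_1(\mathbb{W})\xrightarrow{H_1(B)}H_1(\mathbb{V})\to H_0(\mathrm{hfib}(B))\to H_0(\mathbb{W})\xrightarrow{H_0(B)}H_0(\mathbb{V})\to H_{-1}(\mathrm{hfib}(B))\to0.$$
   Context: A $2$-term $L_\infty$-algebra $\mathbb{V}$ over $K$ is a linear map of $K$-modules $\partial:V_1\to V_0$ with bilinear brackets $[\cdot,\cdot]:V_i\times V_j\to V_{i+j}$ ($i+j=0,1$) and an antisymmetric trilinear map $\langle\cdot,\cdot,\cdot\rangle:V_0^3\to V_1$ such that for $w,x,y,z\in V_0$, $h,k\in V_1$: $[x,y]=-[y,x]$; $[x,h]=-[h,x]$; $\partial[x,h]=[x,\partial h]$; $[\partial h,k]=[h,\partial k]$; $\partial\langle x,y,z\rangle=[x,[y,z]]+[y,[z,x]]+[z,[x,y]]$; $\langle x,y,\partial h\rangle=[x,[y,h]]+[y,[h,x]]+[h,[x,y]]$; and $[\langle x,y,z\rangle,w]-[\langle w,x,y\rangle,z]+[\langle z,w,x\rangle,y]-[\langle y,z,w\rangle,x]=\langle[x,y],z,w\rangle+\langle[z,w],x,y\rangle+\langle[x,z],w,y\rangle+\langle[w,y],x,z\rangle+\langle[x,w],y,z\rangle+\langle[y,z],x,w\rangle$.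 Put $H_1(\mathbb{V})=\ker\partial$, $H_0(\mathbb{V})=\mathrm{coker}\,\partial$. A butterfly $B:\mathbb{W}\to\mathbb{V}$ is a $K$-module $E$ with an antisymmetric bilinear bracket and linear maps $\kappa:W_1\to E$, $\iota:V_1\to E$, $\sigma:E\to W_0$, $\rho:E\to V_0$ with $\sigma\kappa=\partial_{\mathbb W}$, $\rho\iota=\partial_{\mathbb V}$, $\rho\kappa=0$, $0\to V_1\xrightarrow{\iota}E\xrightarrow{\sigma}W_0\to0$ exact, $\rho$ and $\sigma$ bracket-preserving, $[a,\iota(h)]=\iota[\rho(a),h]$, $[a,\kappa(l)]=\kappa[\sigma(a),l]$, and $\iota\langle\rho a,\rho b,\rho c\rangle+\kappa\langle\sigma a,\sigma b,\sigma c\rangle=[a,[b,c]]+[b,[c,a]]+[c,[a,b]]$. The induced maps are: $H_0(B)$ sends the class of $w\in W_0$ to the class of $\rho(e)$ for any $e\in E$ with $\sigma(e)=w$; $H_1(B)$ sends $l\in\ker\partial_{\mathbb W}$ to $-\iota^{-1}(\kappa(l))\in\ker\partial_{\mathbb V}$. The unnamed maps in the sequence are the natural ones induced by the inclusion $\ker\kappa\subseteq\ker\partial_{\mathbb W}$, by $\iota$, by $\sigma$, and by the identity of $V_0$. *)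

(* Defs.v *)
From HB Require Import structures.
From mathcomp Require Import all_boot all_algebra.
From mathcomp Require Import generic_quotient ring_quotient boolp.

Set Implicit Arguments.
Unset Strict Implicit.
Unset Printing Implicit Defensive.

Import GRing.Theory.
Local Open Scope ring_scope.
Local Open Scope quotient_scope.

Section Kernel.
Variables (K : comPzRingType) (U V : lmodType K) (f : {linear U -> V}).

Definition ker_pred : {pred U} := fun x => f x == 0.

Lemma ker_predP : submod_closed ker_pred.
Proof.
split; first by rewrite unfold_in linear0.
move=> a u v; rewrite !unfold_in => /eqP fu /eqP fv.
by rewrite linearP fu fv scaler0 addr0.
Qed.
HB.instance Definition _ := GRing.isSubmodClosed.Build K U ker_pred ker_predP.

Record ker := Ker { ker_val : U; _ : ker_val \in ker_pred }.

HB.instance Definition _ := [isSub for ker_val].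
HB.instance Definition _ := [Choice of ker by <:].
HB.instance Definition _ := [SubChoice_isSubLmodule of ker by <:].

Lemma ker_valP (x : ker) : f (val x) = 0.
Proof. exact/eqP/(valP x). Qed.

End Kernel.

(* Membership in an image is not decidable, hence the classical truth value. *)
Section Cokernel.
Variables (K : comPzRingType) (U V : lmodType K) (f : {linear U -> V}).

Definition im_pred : {pred V} := fun y => `[< exists x, f x = y >].

Lemma im_predP : submod_closed im_pred.
Proof.
split; first by apply/asboolP; exists 0; rewrite linear0.
move=> a _ _ /asboolP[u <-] /asboolP[v <-].
by apply/asboolP; exists (a *: u + v); rewrite linearP.
Qed.
HB.instance Definition _ := GRing.isSubmodClosed.Build K V im_pred im_predP.

Definition coker := Quotient.quot im_pred.
HB.instance Definition _ := GRing.Zmodule.on coker.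
HB.instance Definition _ := ZmodQuotient.on coker.

Lemma pi_cokerP (x y : V) :
  \pi_coker x = \pi_coker y <-> exists u, f u = x - y.
Proof.
split=> [/eqP|[u fu]]; first by rewrite -Quotient.idealrBE => /asboolP.
by apply/eqP; rewrite -Quotient.idealrBE; apply/asboolP; exists u.
Qed.

Definition scale_coker (a : K) (q : coker) : coker :=
  \pi_coker (a *: repr q).

Lemma pi_coker_scale a x : scale_coker a (\pi_coker x) = \pi_coker (a *: x).
Proof.
apply/pi_cokerP.
have /pi_cokerP[u fu] : \pi_coker (repr (\pi_coker x)) = \pi_coker x.
  by rewrite reprK.
by exists (a *: u); rewrite linearZZ fu scalerBr.
Qed.

Fact coker_scalerA a b q :
  scale_coker a (scale_coker b q) = scale_coker (a * b) q.
Proof. by rewrite -[q]reprK !pi_coker_scale reprK scalerA. Qed.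
Fact coker_scale1r : left_id 1 scale_coker.
Proof. by move=> q; rewrite -[q]reprK pi_coker_scale scale1r. Qed.
Fact coker_scalerDr : right_distributive scale_coker +%R.
Proof.
move=> a p q; rewrite -[p]reprK -[q]reprK.
by rewrite -raddfD !pi_coker_scale -raddfD scalerDr.
Qed.
Fact coker_scalerDl q : {morph scale_coker^~ q : a b / a + b}.
Proof.
by move=> a b; rewrite -[q]reprK !pi_coker_scale -raddfD scalerDl.
Qed.
HB.instance Definition _ := GRing.Zmodule_isLmodule.Build K coker
  coker_scalerA coker_scale1r coker_scalerDr coker_scalerDl.

Definition coker_pi (y : V) : coker := \pi_coker y.

Fact coker_pi_linear : linear coker_pi.
Proof.
move=> a x y; rewrite /coker_pi raddfD; congr (_ + _).
exact: esym (pi_coker_scale a x).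
Qed.
HB.instance Definition _ :=
  GRing.isLinear.Build K V coker *:%R coker_pi coker_pi_linear.

Lemma coker_pi_surj q : exists y, coker_pi y = q.
Proof. by exists (repr q); rewrite /coker_pi reprK. Qed.

Lemma coker_pi_eq0 y : coker_pi y = 0 <-> exists x, f x = y.
Proof. by rewrite -(linear0 coker_pi) pi_cokerP subr0. Qed.

End Cokernel.

Section UniversalMaps.
Variables (K : comPzRingType) (T U V : lmodType K).

Section KerLift.
Variables (f : {linear U -> V}) (g : {linear T -> U}).
Hypothesis fg0 : forall t, f (g t) = 0.

Fact ker_lift_proof t : g t \in ker_pred f.
Proof. by rewrite unfold_in fg0. Qed.
Definition ker_lift_fun (t : T) : ker f := Ker (ker_lift_proof t).
Fact ker_lift_linear : linear ker_lift_fun.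
Proof. by move=> a x y; apply: val_inj; rewrite /= linearP. Qed.
HB.instance Definition _ :=
  GRing.isLinear.Build K T (ker f) *:%R ker_lift_fun ker_lift_linear.
Definition ker_lift : {linear T -> ker f} := ker_lift_fun.

Lemma ker_liftE t : val (ker_lift t) = g t.
Proof. by []. Qed.
End KerLift.

Section CokerDesc.
Variables (f : {linear T -> U}) (g : {linear U -> V}).
Hypothesis gf0 : forall t, g (f t) = 0.

Definition coker_desc_fun (q : coker f) : V := g (repr q).
Lemma coker_desc_funE u : coker_desc_fun (coker_pi f u) = g u.
Proof.
have /pi_cokerP[t ft] : \pi_(coker f) (repr (coker_pi f u)) = \pi u.
  by rewrite reprK.
by apply/eqP; rewrite -subr_eq0 -linearB -ft gf0.
Qed.
Fact coker_desc_linear : linear coker_desc_fun.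
Proof.
move=> a p q; have [x <-] := coker_pi_surj p; have [y <-] := coker_pi_surj q.
by rewrite -linearP !coker_desc_funE linearP.
Qed.
HB.instance Definition _ :=
  GRing.isLinear.Build K (coker f) V *:%R coker_desc_fun coker_desc_linear.
Definition coker_desc : {linear coker f -> V} := coker_desc_fun.

Lemma coker_descE u : coker_desc (coker_pi f u) = g u.
Proof. exact: coker_desc_funE. Qed.
End CokerDesc.

End UniversalMaps.

Definition exact_at (K : comPzRingType) (A B C : lmodType K)
    (f : {linear A -> B}) (g : {linear B -> C}) : Prop :=
  forall b, g b = 0 <-> exists a, f a = b.

Definition surjective (A B : Type) (f : A -> B) : Prop :=
  forall b, exists a, f a = b.

(* Complexes concentrated in degrees 1, 0, -1. *)
Record complex3 (K : comPzRingType) := Complex3 {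
  cx1 : lmodType K;
  cx0 : lmodType K;
  cxm1 : lmodType K;
  cx_d1 : {linear cx1 -> cx0};
  cx_d0 : {linear cx0 -> cxm1};
  cx_dd : forall x, cx_d0 (cx_d1 x) = 0
}.

Section ComplexHomology.
Variables (K : comPzRingType) (C : complex3 K).
Definition cxH1 : lmodType K := ker (cx_d1 C).
Definition cxH0 : lmodType K := coker (ker_lift (@cx_dd K C)).
Definition cxHm1 : lmodType K := coker (cx_d0 C).
End ComplexHomology.

(* The library's {bilinear _ -> _ -> _} excludes the zero ring of scalars. *)
Definition bilinear_map (K : comPzRingType) (A B C : lmodType K)
    (f : A -> B -> C) : Prop :=
  (forall b, linear (fun a => f a b)) /\ (forall a, linear (f a)).

Definition trilinear_map (K : comPzRingType) (A B C D : lmodType K)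
    (f : A -> B -> C -> D) : Prop :=
  [/\ forall b c, linear (fun a => f a b c),
      forall a c, linear (fun b => f a b c)
    & forall a b, linear (f a b)].

(* tl_brij is the bracket V_i x V_j -> V_{i+j}. *)
Record twoterm_Linf (K : comPzRingType) := TwoTermLinf {
  tl1 : lmodType K;
  tl0 : lmodType K;
  tl_d : {linear tl1 -> tl0};
  tl_br00 : tl0 -> tl0 -> tl0;
  tl_br01 : tl0 -> tl1 -> tl1;
  tl_br10 : tl1 -> tl0 -> tl1;
  tl_tri : tl0 -> tl0 -> tl0 -> tl1;
  tl_br00_bilin : bilinear_map tl_br00;
  tl_br01_bilin : bilinear_map tl_br01;
  tl_br10_bilin : bilinear_map tl_br10;
  tl_tri_trilin : trilinear_map tl_tri;
  tl_tri_anti12 : forall x y z, tl_tri x y z = - tl_tri y x z;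
  tl_tri_anti23 : forall x y z, tl_tri x y z = - tl_tri x z y;
  tl_br00_anti : forall x y, tl_br00 x y = - tl_br00 y x;
  tl_br01_anti : forall x h, tl_br01 x h = - tl_br10 h x;
  tl_d_br01 : forall x h, tl_d (tl_br01 x h) = tl_br00 x (tl_d h);
  tl_peiffer : forall h k, tl_br01 (tl_d h) k = tl_br10 h (tl_d k);
  tl_jac000 : forall x y z,
    tl_d (tl_tri x y z) =
      tl_br00 x (tl_br00 y z) + tl_br00 y (tl_br00 z x)
      + tl_br00 z (tl_br00 x y);
  tl_jac001 : forall x y h,
    tl_tri x y (tl_d h) =
      tl_br01 x (tl_br01 y h) + tl_br01 y (tl_br10 h x)
      + tl_br10 h (tl_br00 x y);
  tl_coh : forall w x y z,
    tl_br10 (tl_tri x y z) w - tl_br10 (tl_tri w x y) z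
      + tl_br10 (tl_tri z w x) y - tl_br10 (tl_tri y z w) x =
    tl_tri (tl_br00 x y) z w + tl_tri (tl_br00 z w) x y
      + tl_tri (tl_br00 x z) w y + tl_tri (tl_br00 w y) x z
      + tl_tri (tl_br00 x w) y z + tl_tri (tl_br00 y z) x w
}.

Definition tlH1 (K : comPzRingType) (V : twoterm_Linf K) : lmodType K :=
  ker (tl_d V).
Definition tlH0 (K : comPzRingType) (V : twoterm_Linf K) : lmodType K :=
  coker (tl_d V).

Record butterfly (K : comPzRingType) (W V : twoterm_Linf K) := Butterfly {
  bf_E : lmodType K;
  bf_br : bf_E -> bf_E -> bf_E;
  bf_kappa : {linear tl1 W -> bf_E};
  bf_iota : {linear tl1 V -> bf_E};
  bf_sigma : {linear bf_E -> tl0 W};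
  bf_rho : {linear bf_E -> tl0 V};
  bf_br_bilin : bilinear_map bf_br;
  bf_br_anti : forall a b, bf_br a b = - bf_br b a;
  bf_sigma_kappa : forall l, bf_sigma (bf_kappa l) = tl_d W l;
  bf_rho_iota : forall h, bf_rho (bf_iota h) = tl_d V h;
  bf_rho_kappa : forall l, bf_rho (bf_kappa l) = 0;
  bf_iota_inj : injective bf_iota;
  bf_exact : exact_at bf_iota bf_sigma;
  bf_sigma_surj : surjective bf_sigma;
  bf_rho_br : forall a b, bf_rho (bf_br a b) = tl_br00 (bf_rho a) (bf_rho b);
  bf_sigma_br : forall a b,
    bf_sigma (bf_br a b) = tl_br00 (bf_sigma a) (bf_sigma b);
  bf_br_iota : forall a h,
    bf_br a (bf_iota h) = bf_iota (tl_br01 (bf_rho a) h);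
  bf_br_kappa : forall a l,
    bf_br a (bf_kappa l) = bf_kappa (tl_br01 (bf_sigma a) l);
  bf_jac : forall a b c,
    bf_iota (tl_tri (bf_rho a) (bf_rho b) (bf_rho c))
      + bf_kappa (tl_tri (bf_sigma a) (bf_sigma b) (bf_sigma c)) =
    bf_br a (bf_br b c) + bf_br b (bf_br c a) + bf_br c (bf_br a b)
}.

Definition hfib (K : comPzRingType) (W V : twoterm_Linf K)
    (B : butterfly W V) : complex3 K :=
  Complex3 (@bf_rho_kappa K W V B).

Section ButterflyMaps.
Variables (K : comPzRingType) (W V : twoterm_Linf K) (B : butterfly W V).
Local Notation kappa := (bf_kappa B).
Local Notation iota := (bf_iota B).
Local Notation sigma := (bf_sigma B).
Local Notation rho := (bf_rho B).

Fact bf_iota_inv_ex (e : ker sigma) : exists h, iota h == val e.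
Proof. by have [h hP] := (bf_exact _).1 (ker_valP e); exists h; apply/eqP. Qed.
Definition bf_iota_inv_fun (e : ker sigma) : tl1 V :=
  xchoose (bf_iota_inv_ex e).
Lemma bf_iota_inv_funK e : iota (bf_iota_inv_fun e) = val e.
Proof. exact/eqP/(xchooseP (bf_iota_inv_ex e)). Qed.
Fact bf_iota_inv_linear : linear bf_iota_inv_fun.
Proof.
move=> a x y; apply: (@bf_iota_inj _ _ _ B).
by rewrite linearP !bf_iota_inv_funK linearP.
Qed.
HB.instance Definition _ := GRing.isLinear.Build K (ker sigma) (tl1 V) *:%R
  bf_iota_inv_fun bf_iota_inv_linear.
Definition bf_iota_inv : {linear ker sigma -> tl1 V} := bf_iota_inv_fun.

Fact bf_kappa_ker (l : tlH1 W) : sigma ((kappa \o val) l) = 0.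
Proof. by rewrite /= bf_sigma_kappa (ker_valP l). Qed.
Definition bf_kappa_lift : {linear tlH1 W -> ker sigma} :=
  ker_lift bf_kappa_ker.

Fact bf_H1_ker (l : tlH1 W) :
  tl_d V ((-%R \o (bf_iota_inv \o bf_kappa_lift)) l) = 0.
Proof.
by rewrite /= linearN -(bf_rho_iota B) bf_iota_inv_funK /= bf_rho_kappa oppr0.
Qed.
Definition bf_H1 : {linear tlH1 W -> tlH1 V} := ker_lift bf_H1_ker.

Lemma bf_H1E (l : tlH1 W) : iota (val (bf_H1 l)) = - kappa (val l).
Proof. by rewrite /= linearN bf_iota_inv_funK. Qed.

Fact bf_sect_ex (w : tl0 W) : exists e, sigma e == w.
Proof. by have [e eP] := bf_sigma_surj B w; exists e; apply/eqP. Qed.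
Definition bf_sect (w : tl0 W) : bf_E B := xchoose (bf_sect_ex w).
Lemma bf_sectK w : sigma (bf_sect w) = w.
Proof. exact/eqP/(xchooseP (bf_sect_ex w)). Qed.

Lemma bf_rho_pi_ker e : sigma e = 0 -> coker_pi (tl_d V) (rho e) = 0.
Proof.
move=> /bf_exact[h <-]; apply/coker_pi_eq0; exists h.
by rewrite bf_rho_iota.
Qed.
Definition bf_H0_fun (w : tl0 W) : tlH0 V :=
  coker_pi (tl_d V) (rho (bf_sect w)).
Lemma bf_H0_funE e : bf_H0_fun (sigma e) = coker_pi (tl_d V) (rho e).
Proof.
apply/eqP; rewrite -subr_eq0 -!linearB; apply/eqP/bf_rho_pi_ker.
by rewrite linearB bf_sectK subrr.
Qed.
Fact bf_H0_fun_linear : linear bf_H0_fun.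
Proof.
move=> a x y.
have -> : a *: x + y = sigma (a *: bf_sect x + bf_sect y).
  by rewrite linearP !bf_sectK.
by rewrite bf_H0_funE !linearP.
Qed.
HB.instance Definition _ := GRing.isLinear.Build K (tl0 W) (tlH0 V) *:%R
  bf_H0_fun bf_H0_fun_linear.

Fact bf_H0_desc (l : tl1 W) : bf_H0_fun (tl_d W l) = 0.
Proof. by rewrite -(bf_sigma_kappa B) bf_H0_funE bf_rho_kappa linear0. Qed.
Definition bf_H0 : {linear tlH0 W -> tlH0 V} := coker_desc bf_H0_desc.

Lemma bf_H0E w e : sigma e = w ->
  bf_H0 (coker_pi (tl_d W) w) = coker_pi (tl_d V) (rho e).
Proof. by move=> <-; apply: etrans (bf_H0_funE e); apply: coker_descE. Qed.

Fact hfib_H1_ker (l : cxH1 (hfib B)) : tl_d W (val l) = 0.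
Proof.
by rewrite -(bf_sigma_kappa B) (ker_valP l : kappa _ = 0) linear0.
Qed.
Definition hfib_H1_W : {linear cxH1 (hfib B) -> tlH1 W} :=
  ker_lift hfib_H1_ker.

Fact bf_iota_ker (h : tlH1 V) : rho ((iota \o val) h) = 0.
Proof. by rewrite /= bf_rho_iota (ker_valP h). Qed.
Definition hfib_connect : {linear tlH1 V -> cxH0 (hfib B)} :=
  coker_pi (ker_lift (@cx_dd K (hfib B))) \o ker_lift bf_iota_ker.

Fact hfib_H0_desc (l : tl1 W) :
  (coker_pi (tl_d W) \o (sigma \o val)) (ker_lift (@cx_dd K (hfib B)) l) = 0.
Proof. by apply/coker_pi_eq0; exists l; rewrite /= bf_sigma_kappa. Qed.
Definition hfib_H0_W : {linear cxH0 (hfib B) -> tlH0 W} :=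
  coker_desc hfib_H0_desc.

Fact hfib_Hm1_desc (h : tl1 V) : coker_pi rho (tl_d V h) = 0.
Proof. by apply/coker_pi_eq0; exists (iota h); rewrite bf_rho_iota. Qed.
Definition hfib_V_Hm1 : {linear tlH0 V -> cxHm1 (hfib B)} :=
  coker_desc hfib_Hm1_desc.

End ButterflyMaps.

(* Main.v *)
(** An element of [W_0] lifts to [E] along [sigma], uniquely up to [iota]; an
    element of [E] represents a class in [H_0(hfib B)] when [rho] kills it,
    uniquely up to [kappa]. In the chase a lift is corrected by [iota] to land in
    [ker rho], or by [kappa] to land in [ker sigma], the image of [iota]. *)

Require Import Defs.
From mathcomp Require Import all_boot all_algebra.

Import GRing.Theory.
Local Open Scope ring_scope.

Section LongExactSequence.
Context {K : comPzRingType} {W V : twoterm_Linf K} (B : butterfly W V).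
Local Notation kappa := (bf_kappa B).
Local Notation iota := (bf_iota B).
Local Notation sigma := (bf_sigma B).
Local Notation rho := (bf_rho B).
Local Notation pi0 := (coker_pi (ker_lift (@cx_dd K (hfib B)))).

Lemma bf_sigma_iota h : sigma (iota h) = 0.
Proof. by apply/bf_exact; exists h. Qed.

(** Since [val] is injective on [ker rho], a boundary relation there can be tested in [E]. *)
Lemma hfib_H0_pi_eq (x y : ker rho) :
  pi0 x = pi0 y <-> exists l, kappa l = val x - val y.
Proof.
rewrite (rwP eqP) -subr_eq0 -linearB -(rwP eqP) coker_pi_eq0.
split=> -[l kl]; exists l; first by rewrite -linearB -kl.
by apply: val_inj; rewrite /= kl.
Qed.

Lemma hfib_connectE (h : tlH1 V) (e : ker rho) :
  hfib_connect B h = pi0 e <-> exists l, kappa l = iota (val h) - val e.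
Proof. exact: hfib_H0_pi_eq. Qed.

Lemma hfib_H0_WE (e : ker rho) :
  hfib_H0_W B (pi0 e) = coker_pi (tl_d W) (sigma (val e)).
Proof. exact: coker_descE. Qed.

Lemma hfib_V_Hm1E v :
  hfib_V_Hm1 B (coker_pi (tl_d V) v) = coker_pi rho v.
Proof. exact: coker_descE. Qed.

Lemma hfib_H1_W_inj : injective (hfib_H1_W B).
Proof. by move=> x y [xy]; apply: val_inj. Qed.

(** Injectivity of [iota] turns the vanishing of [bf_H1 B l] into [kappa (val l) = 0]. *)
Lemma exact_at_H1_W : exact_at (hfib_H1_W B) (bf_H1 B).
Proof.
move=> l; split=> [Hl0|[a <-]].
  have kl : val l \in ker_pred kappa.
    by rewrite unfold_in -oppr_eq0 -bf_H1E Hl0 linear0.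
  by exists (Ker kl); apply: val_inj.
apply/val_inj/(@bf_iota_inj _ _ _ B).
by rewrite bf_H1E (ker_valP a : kappa _ = 0) oppr0 linear0.
Qed.

Lemma exact_at_H1_V : exact_at (bf_H1 B) (hfib_connect B).
Proof.
move=> h; rewrite -(linear0 pi0) hfib_connectE subr0.
split=> [[l kl]|[l <-]].
  (* The minus sign in [bf_H1] makes [- l], not [l], the preimage of [h]. *)
  have dl : - l \in ker_pred (tl_d W).
    by rewrite unfold_in linearN -(bf_sigma_kappa B) kl bf_sigma_iota oppr0.
  exists (Ker dl); apply/val_inj/(@bf_iota_inj _ _ _ B).
  by rewrite bf_H1E /= linearN opprK.
by exists (- val l); rewrite bf_H1E linearN.
Qed.

Lemma exact_at_hfib_H0 : exact_at (hfib_connect B) (hfib_H0_W B).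
Proof.
move=> q; have [e <-] := coker_pi_surj q; rewrite hfib_H0_WE coker_pi_eq0.
split=> [[l dl]|[h /hfib_connectE[l kl]]].
  (* Both [val e] and [kappa l] lie over [tl_d W l], so their difference is some [iota h]. *)
  have [|h ih] := (bf_exact (val e - kappa l)).1.
    by rewrite linearB bf_sigma_kappa dl subrr.
  have dh : h \in ker_pred (tl_d V).
    rewrite unfold_in -(bf_rho_iota B) ih linearB bf_rho_kappa subr0.
    by rewrite ker_valP.
  exists (Ker dh); apply/hfib_connectE; exists (- l).
  by rewrite /= ih linearN addrAC subrr sub0r.
(* Applying [sigma] to [kl] kills the [iota] term and leaves [tl_d W l = - sigma (val e)]. *)
exists (- l); rewrite linearN -(bf_sigma_kappa B) kl linearB bf_sigma_iota.
by rewrite sub0r opprK.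
Qed.

Lemma exact_at_H0_W : exact_at (hfib_H0_W B) (bf_H0 B).
Proof.
move=> p; have [w <-] := coker_pi_surj p; have [e <-] := bf_sigma_surj B w.
rewrite (bf_H0E (erefl _)); split=> [/coker_pi_eq0[h dh]|[q]].
  (* Subtracting [iota h] cancels [rho e = tl_d V h] and leaves [sigma e] unchanged. *)
  have re : e - iota h \in ker_pred rho.
    by rewrite unfold_in linearB bf_rho_iota dh subrr.
  by exists (pi0 (Ker re)); rewrite hfib_H0_WE linearB bf_sigma_iota subr0.
(* As [e] and [val x] lie over the same class of [tlH0 W], [bf_H0] may be computed from [val x],
   which [rho] kills. *)
have [x <-] := coker_pi_surj q; rewrite hfib_H0_WE => xe.
by rewrite -(bf_H0E (erefl _)) -xe (bf_H0E (erefl _)) ker_valP linear0.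
Qed.

Lemma exact_at_H0_V : exact_at (bf_H0 B) (hfib_V_Hm1 B).
Proof.
move=> p; have [v <-] := coker_pi_surj p; rewrite hfib_V_Hm1E coker_pi_eq0.
split=> [[e <-]|[q]].
  by exists (coker_pi (tl_d W) (sigma e)); rewrite (bf_H0E (erefl _)).
have [w <-] := coker_pi_surj q; have [e <-] := bf_sigma_surj B w.
rewrite (bf_H0E (erefl _)) => /pi_cokerP[h dh].
(* Here [dh] reads [tl_d V h = rho e - v], so the correction by [iota h] moves [rho e] exactly to
   [v]. *)
by exists (e - iota h); rewrite linearB bf_rho_iota dh subKr.
Qed.

Lemma hfib_V_Hm1_surj : surjective (hfib_V_Hm1 B).
Proof.
move=> q; have [v <-] := coker_pi_surj q.
by exists (coker_pi (tl_d V) v); rewrite hfib_V_Hm1E.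
Qed.

End LongExactSequence.

Theorem proposition4p2 (K : comPzRingType) (W V : twoterm_Linf K)
    (B : butterfly W V) :
  injective (hfib_H1_W B) /\
  exact_at (hfib_H1_W B) (bf_H1 B) /\
  exact_at (bf_H1 B) (hfib_connect B) /\
  exact_at (hfib_connect B) (hfib_H0_W B) /\
  exact_at (hfib_H0_W B) (bf_H0 B) /\
  exact_at (bf_H0 B) (hfib_V_Hm1 B) /\
  surjective (hfib_V_Hm1 B).
Proof.
split; first exact: hfib_H1_W_inj.
split; first exact: exact_at_H1_W.
split; first exact: exact_at_H1_V.
split; first exact: exact_at_hfib_H0.
split; first exact: exact_at_H0_W.
split; first exact: exact_at_H0_V.
exact: hfib_V_Hm1_surj.
Qed.
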